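(* $\mathsf{BIM}$ proves the equivalence of: (i) $\mathbf{Contr(BW)}_{\mathcal N}$: for every $\gamma$, if for every $\zeta\in[\omega]^\omega$ there is $n$ with $\gamma(\zeta(n))\ne_n\gamma(\zeta(n+1))$, then $\exists n[\gamma(n)\notin Bin]$; (ii) $\mathbf{SC}(\mathcal C)$: for every $\alpha$ and every $\gamma$ with $\forall n[\gamma(n)\in Bin]$, if for every $\zeta\in[\omega]^\omega$ there is $n$ with $\gamma(\zeta(n+1))\ne_n\gamma(\zeta(n))$ or $\alpha(n)\ne0$, then $\exists n[\alpha(n)\ne0]$.
   Context: $\mathsf{BIM}$ is the two-sorted formal theory with intuitionistic logic of natural numbers and functions $\mathbb N\to\mathbb N$, with extensionality, primitive recursive constants, closure of functions under composition, primitive recursion and unbounded search, and full induction. Finite sequences are coded by naturals with $length(a)$ and entries $a(j)$; $Bin$ is the set of codes of finite 0-1 sequences. $a\ne_n b$ iff there is $j<n$ with $j<length(a)$, $j<length(b)$ and $a(j)\ne b(j)$. $[\omega]^\omega$ is the set of strictly increasing $\zeta:\mathbb N\to\mathbb N$. *)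

(* Defs.v *)
From Stdlib Require Import List.
Import ListNotations.

(** * The language of BIM

    Two sorts of variables, numerical and functional, each with its own space
    of de Bruijn indices: a numerical quantifier does not renumber the function
    variables, and conversely. *)

(** Names for the (unary) primitive recursive functions.  Functions of several
    arguments are treated as unary ones by means of the pairing function:
    [f(m,n)] is [f(J(m,n))] and [f(m,n,p)] is [f(J(J(m,n),p))].  [cK] and [cL]
    are the two projections, [cRec f g] is the function [h] with
    [h(m,0) = f(m)] and [h(m,n+1) = g(m,n,h(m,n))]. *)
Inductive const : Type :=
| cId | cZero | cSucc | cK | cL
| cComp (f g : const)
| cPair (f g : const)
| cRec (f g : const).

Inductive fterm : Type :=
| FVar (i : nat)
| FConst (c : const).

Inductive term : Type :=
| Var (i : nat)
| Zero
| J (t u : term)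
| App (f : fterm) (t : term).

(** [EqN] is equality of numbers, [EqF] equality of functions. *)
Inductive form : Type :=
| EqN (t u : term)
| EqF (f g : fterm)
| Bot
| And (A B : form)
| Or (A B : form)
| Imp (A B : form)
| AllN (A : form)
| ExN (A : form)
| AllF (A : form)
| ExF (A : form).

Definition Not (A : form) : form := Imp A Bot.
Definition Iff (A B : form) : form := And (Imp A B) (Imp B A).

(** ** Simultaneous substitution of numerical and functional terms *)

Definition fsubst (r : nat -> fterm) (f : fterm) : fterm :=
  match f with
  | FVar i => r i
  | FConst c => FConst c
  end.

Fixpoint tsubst (s : nat -> term) (r : nat -> fterm) (t : term) : term :=
  match t with
  | Var i => s i
  | Zero => Zero
  | J t u => J (tsubst s r t) (tsubst s r u)
  | App f t => App (fsubst r f) (tsubst s r t)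
  end.

Definition tshiftN (t : term) : term := tsubst (fun i => Var (S i)) FVar t.
Definition tshiftF (t : term) : term := tsubst Var (fun i => FVar (S i)) t.
Definition fshiftF (f : fterm) : fterm := fsubst (fun i => FVar (S i)) f.

Definition upN (s : nat -> term) (i : nat) : term :=
  match i with
  | 0 => Var 0
  | S j => tshiftN (s j)
  end.

Definition upF (r : nat -> fterm) (i : nat) : fterm :=
  match i with
  | 0 => FVar 0
  | S j => fshiftF (r j)
  end.

Fixpoint subst (s : nat -> term) (r : nat -> fterm) (A : form) : form :=
  match A with
  | EqN t u => EqN (tsubst s r t) (tsubst s r u)
  | EqF f g => EqF (fsubst r f) (fsubst r g)
  | Bot => Bot
  | And A B => And (subst s r A) (subst s r B)
  | Or A B => Or (subst s r A) (subst s r B)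
  | Imp A B => Imp (subst s r A) (subst s r B)
  | AllN A => AllN (subst (upN s) r A)
  | ExN A => ExN (subst (upN s) r A)
  | AllF A => AllF (subst (fun i => tshiftF (s i)) (upF r) A)
  | ExF A => ExF (subst (fun i => tshiftF (s i)) (upF r) A)
  end.

Definition shiftN (A : form) : form := subst (fun i => Var (S i)) FVar A.
Definition shiftF (A : form) : form := subst Var (fun i => FVar (S i)) A.

Definition instN (t : term) (A : form) : form :=
  subst (fun i => match i with 0 => t | S j => Var j end) FVar A.
Definition instF (f : fterm) (A : form) : form :=
  subst Var (fun i => match i with 0 => f | S j => FVar j end) A.

(** * Abbreviations *)

Definition appc (c : const) (t : term) : term := App (FConst c) t.
Definition Suc (t : term) : term := appc cSucc t.
Definition One : term := Suc Zero.

Definition add (t u : term) : term :=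
  appc (cRec cId (cComp cSucc cL)) (J t u).
Definition pred (t : term) : term :=
  appc (cRec cZero (cComp cL cK)) (J Zero t).
(** Truncated subtraction; the step function sends [(m,n,p)] to [p - 1]. *)
Definition sub (t u : term) : term :=
  appc (cRec cId (cComp (cComp (cRec cZero (cComp cL cK)) (cPair cZero cId)) cL))
      (J t u).
(** [ifz t u v] is [u] if [t = 0], and [v] otherwise. *)
Definition ifz (t u v : term) : term :=
  appc (cRec cK (cComp cL (cComp cK cK))) (J (J u v) t).
(** [L] applied [u] times to [t]. *)
Definition iterL (t u : term) : term :=
  appc (cRec cId (cComp cL cL)) (J t u).

Definition Lt (t u : term) : form :=
  ExN (EqN (add (tshiftN t) (Suc (Var 0))) (tshiftN u)).

(** * The theory BIM *)

Inductive BIM : form -> Prop :=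
| ax_ext :
    BIM (AllF (AllF (Iff (EqF (FVar 1) (FVar 0))
                         (AllN (EqN (App (FVar 1) (Var 0)) (App (FVar 0) (Var 0)))))))
(* the constants *)
| ax_id : BIM (AllN (EqN (appc cId (Var 0)) (Var 0)))
| ax_zero : BIM (AllN (EqN (appc cZero (Var 0)) Zero))
| ax_succ_neq0 : BIM (AllN (Not (EqN (Suc (Var 0)) Zero)))
| ax_succ_inj :
    BIM (AllN (AllN (Imp (EqN (Suc (Var 1)) (Suc (Var 0))) (EqN (Var 1) (Var 0)))))
| ax_K : BIM (AllN (AllN (EqN (appc cK (J (Var 1) (Var 0))) (Var 1))))
| ax_L : BIM (AllN (AllN (EqN (appc cL (J (Var 1) (Var 0))) (Var 0))))
| ax_J : BIM (AllN (EqN (J (appc cK (Var 0)) (appc cL (Var 0))) (Var 0)))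
(* these three determine [J] as Cantor's pairing, [J(m,n) = (m+n)(m+n+1)/2 + m] *)
| ax_J00 : BIM (EqN (J Zero Zero) Zero)
| ax_J0S : BIM (AllN (EqN (J Zero (Suc (Var 0))) (Suc (J (Var 0) Zero))))
| ax_JS : BIM (AllN (AllN (EqN (J (Suc (Var 1)) (Var 0))
                               (Suc (J (Var 1) (Suc (Var 0)))))))
| ax_cComp (f g : const) :
    BIM (AllN (EqN (appc (cComp f g) (Var 0)) (appc f (appc g (Var 0)))))
| ax_cPair (f g : const) :
    BIM (AllN (EqN (appc (cPair f g) (Var 0)) (J (appc f (Var 0)) (appc g (Var 0)))))
| ax_cRec0 (f g : const) :
    BIM (AllN (EqN (appc (cRec f g) (J (Var 0) Zero)) (appc f (Var 0))))
| ax_cRecS (f g : const) :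
    BIM (AllN (AllN (EqN (appc (cRec f g) (J (Var 1) (Suc (Var 0))))
                         (appc g (J (J (Var 1) (Var 0))
                                   (appc (cRec f g) (J (Var 1) (Var 0))))))))
(* closure of the set of functions *)
| ax_comp :
    BIM (let alpha := FVar 2 in let beta := FVar 1 in let gamma := FVar 0 in
         AllF (AllF (ExF (AllN
           (EqN (App gamma (Var 0)) (App alpha (App beta (Var 0))))))))
| ax_pair :
    BIM (let alpha := FVar 2 in let beta := FVar 1 in let gamma := FVar 0 in
         AllF (AllF (ExF (AllN
           (EqN (App gamma (Var 0)) (J (App alpha (Var 0)) (App beta (Var 0))))))))
| ax_rec :
    BIM (let alpha := FVar 2 in let beta := FVar 1 in let gamma := FVar 0 in
         let m := Var 1 in let n := Var 0 in
         AllF (AllF (ExF (AllN (AllN (And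
           (EqN (App gamma (J m Zero)) (App alpha m))
           (EqN (App gamma (J m (Suc n)))
                (App beta (J (J m n) (App gamma (J m n)))))))))))
(* unbounded search; [alpha] has index 0 in the premise, 1 under [ExF] *)
| ax_search :
    BIM (AllF (Imp
      (AllN (ExN (EqN (App (FVar 0) (J (Var 1) (Var 0))) Zero)))
      (let alpha := FVar 1 in let gamma := FVar 0 in
       ExF (AllN (And
         (EqN (App alpha (J (Var 0) (App gamma (Var 0)))) Zero)
         (AllN (Imp (Lt (Var 0) (App gamma (Var 1)))
                    (Not (EqN (App alpha (J (Var 1) (Var 0))) Zero)))))))))
(* [A] may contain further free variables of both sorts *)
| ax_induction (A : form) :
    BIM (Imp (And (instN Zero A)
                  (AllN (Imp A (subst (fun i => match i with
                                                | 0 => Suc (Var 0)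
                                                | S j => Var (S j)
                                                end) FVar A))))
             (AllN A)).

(** * Intuitionistic natural deduction with equality, over the axioms of BIM *)

Inductive prv : list form -> form -> Prop :=
| prv_ax G A : BIM A -> prv G A
| prv_hyp G A : In A G -> prv G A
| prv_botE G A : prv G Bot -> prv G A
| prv_andI G A B : prv G A -> prv G B -> prv G (And A B)
| prv_andE1 G A B : prv G (And A B) -> prv G A
| prv_andE2 G A B : prv G (And A B) -> prv G B
| prv_orI1 G A B : prv G A -> prv G (Or A B)
| prv_orI2 G A B : prv G B -> prv G (Or A B)
| prv_orE G A B C :
    prv G (Or A B) -> prv (A :: G) C -> prv (B :: G) C -> prv G C
| prv_impI G A B : prv (A :: G) B -> prv G (Imp A B)
| prv_impE G A B : prv G (Imp A B) -> prv G A -> prv G B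
| prv_allNI G A : prv (map shiftN G) A -> prv G (AllN A)
| prv_allNE G A t : prv G (AllN A) -> prv G (instN t A)
| prv_exNI G A t : prv G (instN t A) -> prv G (ExN A)
| prv_exNE G A C :
    prv G (ExN A) -> prv (A :: map shiftN G) (shiftN C) -> prv G C
| prv_allFI G A : prv (map shiftF G) A -> prv G (AllF A)
| prv_allFE G A f : prv G (AllF A) -> prv G (instF f A)
| prv_exFI G A f : prv G (instF f A) -> prv G (ExF A)
| prv_exFE G A C :
    prv G (ExF A) -> prv (A :: map shiftF G) (shiftF C) -> prv G C
| prv_eqN_refl G t : prv G (EqN t t)
| prv_eqN_subst G A t u :
    prv G (EqN t u) -> prv G (instN t A) -> prv G (instN u A)
| prv_eqF_refl G f : prv G (EqF f f)
| prv_eqF_subst G A f g :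
    prv G (EqF f g) -> prv G (instF f A) -> prv G (instF g A).

Definition BIM_proves (A : form) : Prop := prv [] A.

(** * Finite sequences

    Every number codes exactly one finite sequence: [0] codes the empty
    sequence, and [1 + J(k,c)] codes the sequence [a(0), ..., a(k)] of length
    [k+1] where [c = J(a(0), J(a(1), ... J(a(k-1), a(k))))].  Hence [a(j)] is
    [K (L^j c)] for [j < k] and [L^j c] for [j = k].  The value of [entry a j]
    for [j] not below the length of [a] is immaterial: it is never used. *)

Definition len (a : term) : term :=
  ifz a Zero (Suc (appc cK (pred a))).

Definition entry (a j : term) : term :=
  let k := appc cK (pred a) in
  let c := appc cL (pred a) in
  ifz (sub k j) (iterL c j) (appc cK (iterL c j)).

(** [a] belongs to Bin. *)
Definition Bin (a : term) : form :=
  let j := Var 0 in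
  AllN (Imp (Lt j (len (tshiftN a)))
            (Or (EqN (entry (tshiftN a) j) Zero) (EqN (entry (tshiftN a) j) One))).

(** [a <>_n b] *)
Definition Apart (n a b : term) : form :=
  let j := Var 0 in
  ExN (And (Lt j (tshiftN n))
      (And (Lt j (len (tshiftN a)))
      (And (Lt j (len (tshiftN b)))
           (Not (EqN (entry (tshiftN a) j) (entry (tshiftN b) j)))))).

(** [zeta] belongs to [[omega]^omega]. *)
Definition Incr (zeta : fterm) : form :=
  AllN (Lt (App zeta (Var 0)) (App zeta (Suc (Var 0)))).

(** * The two principles

    In the scope of the quantifier over [zeta] the function variables bound
    outside it are renumbered, which is why [gamma] and [alpha] are introduced
    twice, with different indices. *)

Definition Contr_BW : form :=
  AllF (Imp
    (let gamma := FVar 1 in let zeta := FVar 0 in let n := Var 0 in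
     AllF (Imp (Incr zeta)
       (ExN (Apart n (App gamma (App zeta n)) (App gamma (App zeta (Suc n)))))))
    (let gamma := FVar 0 in let n := Var 0 in
     ExN (Not (Bin (App gamma n))))).

Definition SC_C : form :=
  AllF (AllF (Imp
    (let gamma := FVar 0 in let n := Var 0 in
     AllN (Bin (App gamma n)))
    (Imp
      (let alpha := FVar 2 in let gamma := FVar 1 in let zeta := FVar 0 in
       let n := Var 0 in
       AllF (Imp (Incr zeta)
         (ExN (Or (Apart n (App gamma (App zeta (Suc n))) (App gamma (App zeta n)))
                  (Not (EqN (App alpha n) Zero))))))
      (let alpha := FVar 1 in let n := Var 0 in
       ExN (Not (EqN (App alpha n) Zero)))))).

(* Main.v *)
From Stdlib Require Import List Arith Lia Setoid Morphisms.
Import ListNotations.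
Require Import Defs.

(** From (i) to (ii), replace [gamma(n)] by the one-term sequence [<n>] as soon
    as [alpha(k) <> 0] for some [k < n].  For increasing [zeta], if the search
    for such a [k] has succeeded at [zeta(n+1)], two consecutive one-term
    sequences witness apartness at [n+1]; otherwise the modified sequence still
    agrees with [gamma] at [zeta(n)] and [zeta(n+1)].  A value of the modified
    sequence outside [Bin] differs from that of [gamma], so the search succeeded.

    From (ii) to (i), membership in [Bin] is decided by a primitive recursive
    function; let [alpha(n) = 0] iff [gamma(n)] is in [Bin], and replace the
    values of [gamma] outside [Bin] by the empty sequence.  If apartness of
    [gamma(zeta(n))] and [gamma(zeta(n+1))] is destroyed by the replacement,
    then [alpha(m) <> 0] for [m = zeta(n)] or [m = zeta(n+1)], and this [m] is
    the witness required in (ii). *)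

(** * Substitution *)

Lemma fsubst_comp r r' f :
  fsubst r' (fsubst r f) = fsubst (fun i => fsubst r' (r i)) f.
Proof. destruct f; reflexivity. Qed.

Lemma fsubst_id f : fsubst FVar f = f.
Proof. destruct f; reflexivity. Qed.

Lemma tsubst_ext s s' r r' t :
  (forall i, s i = s' i) -> (forall i, r i = r' i) ->
  tsubst s r t = tsubst s' r' t.
Proof.
  intros Hs Hr; induction t as [i| |t IHt u IHu|f t IHt]; cbn; auto.
  - now rewrite IHt, IHu.
  - rewrite IHt; destruct f; cbn; now rewrite ?Hr.
Qed.

Lemma tsubst_comp s r s' r' t :
  tsubst s' r' (tsubst s r t)
  = tsubst (fun i => tsubst s' r' (s i)) (fun i => fsubst r' (r i)) t.
Proof.
  induction t as [i| |t IHt u IHu|f t IHt]; cbn; auto.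
  - now rewrite IHt, IHu.
  - now rewrite IHt, fsubst_comp.
Qed.

Lemma tsubst_id t : tsubst Var FVar t = t.
Proof.
  induction t as [i| |t IHt u IHu|f t IHt]; cbn; auto.
  - now rewrite IHt, IHu.
  - now rewrite IHt, fsubst_id.
Qed.

Lemma tsubst_upN_shift s r t : tsubst (upN s) r (tshiftN t) = tshiftN (tsubst s r t).
Proof.
  unfold tshiftN; rewrite !tsubst_comp; apply tsubst_ext; intro i; cbn; auto.
  now rewrite fsubst_id.
Qed.

Lemma tsubst_upF_shift s r t :
  tsubst (fun i => tshiftF (s i)) (upF r) (tshiftF t) = tshiftF (tsubst s r t).
Proof. unfold tshiftF; rewrite !tsubst_comp; now apply tsubst_ext. Qed.

Lemma fsubst_upF_shift r f : fsubst (upF r) (fshiftF f) = fshiftF (fsubst r f).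
Proof. destruct f; reflexivity. Qed.

Lemma upN_ext s s' : (forall i, s i = s' i) -> forall i, upN s i = upN s' i.
Proof. intros H [|i]; cbn; now rewrite ?H. Qed.

Lemma upF_ext r r' : (forall i, r i = r' i) -> forall i, upF r i = upF r' i.
Proof. intros H [|i]; cbn; now rewrite ?H. Qed.

Lemma subst_ext A : forall s s' r r',
  (forall i, s i = s' i) -> (forall i, r i = r' i) -> subst s r A = subst s' r' A.
Proof.
  induction A; cbn; intros s s' r r' Hs Hr; f_equal;
    try (apply tsubst_ext; assumption); auto using upN_ext.
  - destruct f; cbn; auto.
  - destruct g; cbn; auto.
  - apply IHA; [intro; now rewrite Hs|now apply upF_ext].
  - apply IHA; [intro; now rewrite Hs|now apply upF_ext].
Qed.

Lemma subst_comp A : forall s r s' r',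
  subst s' r' (subst s r A)
  = subst (fun i => tsubst s' r' (s i)) (fun i => fsubst r' (r i)) A.
Proof.
  induction A; cbn; intros s r s' r'; f_equal;
    auto using tsubst_comp, fsubst_comp;
    rewrite IHA; apply subst_ext; try (now intros; auto using tsubst_upF_shift);
    intros [|i]; cbn; auto using tsubst_upN_shift, fsubst_upF_shift.
Qed.

(** The hypotheses are pointwise because the identity substitution, lifted under a binder, is only
    pointwise equal to the identity; no functional extensionality is assumed. *)
Lemma subst_id A : forall s r,
  (forall i, s i = Var i) -> (forall i, r i = FVar i) -> subst s r A = A.
Proof.
  assert (Ht : forall t s r, (forall i, s i = Var i) -> (forall i, r i = FVar i) ->
                             tsubst s r t = t).
  { intros t s r Hs Hr; rewrite <- (tsubst_id t) at 2; now apply tsubst_ext. }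
  induction A; cbn; intros s r Hs Hr; f_equal; auto.
  - destruct f; cbn; auto.
  - destruct g; cbn; auto.
  - apply IHA; auto; intros [|i]; cbn; now rewrite ?Hs.
  - apply IHA; auto; intros [|i]; cbn; now rewrite ?Hs.
  - apply IHA; [|intros [|i]; cbn; now rewrite ?Hr]; intro; now rewrite Hs.
  - apply IHA; [|intros [|i]; cbn; now rewrite ?Hr]; intro; now rewrite Hs.
Qed.

Lemma subst_instN s r t A :
  subst s r (instN t A) = instN (tsubst s r t) (subst (upN s) r A).
Proof.
  unfold instN; rewrite !subst_comp; apply subst_ext.
  - intros [|i]; cbn; auto.
    unfold tshiftN; rewrite tsubst_comp; cbn; now rewrite tsubst_id.
  - intro i; cbn; now rewrite fsubst_id.
Qed.

Lemma subst_instF s r f A :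
  subst s r (instF f A)
  = instF (fsubst r f) (subst (fun i => tshiftF (s i)) (upF r) A).
Proof.
  unfold instF; rewrite !subst_comp; apply subst_ext.
  - intro i; cbn; unfold tshiftF; rewrite tsubst_comp; cbn; now rewrite tsubst_id.
  - intros [|i]; cbn; auto.
    unfold fshiftF; rewrite fsubst_comp; cbn; now rewrite fsubst_id.
Qed.

Lemma subst_shiftN s r A : subst (upN s) r (shiftN A) = shiftN (subst s r A).
Proof.
  unfold shiftN; rewrite !subst_comp; apply subst_ext; intro i; cbn; auto.
  now rewrite fsubst_id.
Qed.

Lemma subst_shiftF s r A :
  subst (fun i => tshiftF (s i)) (upF r) (shiftF A) = shiftF (subst s r A).
Proof. unfold shiftF; rewrite !subst_comp; now apply subst_ext. Qed.

Lemma map_subst_shiftN s r G :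
  map (subst (upN s) r) (map shiftN G) = map shiftN (map (subst s r) G).
Proof. rewrite !map_map; apply map_ext; intro; apply subst_shiftN. Qed.

Lemma map_subst_shiftF s r G :
  map (subst (fun i => tshiftF (s i)) (upF r)) (map shiftF G)
  = map shiftF (map (subst s r) G).
Proof. rewrite !map_map; apply map_ext; intro; apply subst_shiftF. Qed.

(** * Derivations are closed under weakening and substitution *)

(** Every axiom other than induction is closed, so substitution leaves it fixed. An instance of
    induction for [A] becomes the instance for [subst (upN s) r A], since the scheme admits
    parameters. *)
Lemma BIM_subst A : BIM A -> forall s r, BIM (subst s r A).
Proof.
  destruct 1; intros s r; try (cbn; constructor).
  cbn [subst]; rewrite subst_instN.
  replace (subst (upN s) r (subst _ FVar A))
    with (subst (fun i => match i with 0 => Suc (Var 0) | S j => Var (S j) end) FVar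
                (subst (upN s) r A)).
  - apply ax_induction.
  - rewrite !subst_comp; apply subst_ext.
    + intros [|i]; cbn; auto.
      unfold tshiftN; rewrite tsubst_comp; now apply tsubst_ext.
    + intro i; cbn; now rewrite fsubst_id.
Qed.

Lemma prv_weaken G G' A : incl G G' -> prv G A -> prv G' A.
Proof.
  intros I H; revert G' I; induction H; intros G' I;
    try (econstructor; now eauto using incl_map).
  - apply prv_orE with A B; auto; [apply IHprv2|apply IHprv3];
      apply incl_cons; cbn; auto using incl_tl.
  - apply prv_impI, IHprv, incl_cons; cbn; auto using incl_tl.
  - apply prv_exNE with A; auto; apply IHprv2, incl_cons; cbn; auto.
    apply incl_tl, incl_map, I.
  - apply prv_exFE with A; auto; apply IHprv2, incl_cons; cbn; auto.
    apply incl_tl, incl_map, I.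
Qed.

(** This is what allows the fresh variable of a derivation to be renamed to index 0, as the
    eigenvariable rules require. *)
Lemma prv_subst G A :
  prv G A -> forall s r, prv (map (subst s r) G) (subst s r A).
Proof.
  induction 1; intros s r; cbn [subst map] in *; rewrite ?subst_instN, ?subst_instF;
    try (econstructor; now eauto using in_map, BIM_subst).
  - apply prv_allNI; rewrite <- map_subst_shiftN; auto.
  - apply prv_exNI with (tsubst s r t); rewrite <- subst_instN; auto.
  - apply prv_exNE with (subst (upN s) r A); auto.
    rewrite <- map_subst_shiftN, <- subst_shiftN; apply IHprv2.
  - apply prv_allFI; rewrite <- map_subst_shiftF; auto.
  - apply prv_exFI with (fsubst r f); rewrite <- subst_instF; auto.
  - apply prv_exFE with (subst (fun i => tshiftF (s i)) (upF r) A); auto.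
    rewrite <- map_subst_shiftF, <- subst_shiftF; apply IHprv2.
  - apply prv_eqN_subst with (tsubst s r t); auto; rewrite <- subst_instN; auto.
  - apply prv_eqF_subst with (fsubst r f); auto; rewrite <- subst_instF; auto.
Qed.

Ltac below := intros;
  match goal with H : forall i, i < _ -> _ = _ |- _ => apply H; lia end.

(** A formula has finitely many free variables. Phrasing this through agreement of substitutions
    avoids a separate notion of free variable; one bound [N] serves both sorts, and the bound for
    the body of a quantifier also serves outside it. *)
Lemma fresh A : exists N, forall s s' r r',
  (forall i, i < N -> s i = s' i) -> (forall i, i < N -> r i = r' i) ->
  subst s r A = subst s' r' A.
Proof.
  assert (Hf : forall f, exists N, forall r r',
            (forall i, i < N -> r i = r' i) -> fsubst r f = fsubst r' f).
  { intros [i|c]; [exists (S i); cbn; below|exists 0; auto]. }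
  assert (Ht : forall t, exists N, forall s s' r r',
            (forall i, i < N -> s i = s' i) -> (forall i, i < N -> r i = r' i) ->
            tsubst s r t = tsubst s' r' t).
  { induction t as [i| |t [N IHt] u [M IHu]|f t [N IHt]].
    - exists (S i); cbn; below.
    - exists 0; cbn; auto.
    - exists (N + M); cbn; intros; f_equal; [apply IHt|apply IHu]; below.
    - destruct (Hf f) as [M H]; exists (N + M); cbn; intros; f_equal;
        [apply H|apply IHt]; below. }
  induction A as [t u|f g| |A [N HA] B [M HB]|A [N HA] B [M HB]|A [N HA] B [M HB]
                 |A [N HA]|A [N HA]|A [N HA]|A [N HA]];
    [destruct (Ht t) as [N HA], (Ht u) as [M HB]
    |destruct (Hf f) as [N HA], (Hf g) as [M HB]|exists 0; auto|..];
    try (exists (N + M); intros; cbn; f_equal; [apply HA|apply HB]; now below).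
  all: exists N; intros s s' r r' Hs Hr; cbn; f_equal; apply HA; auto;
    try (intros; f_equal; below); intros [|i] Hi; cbn; auto; f_equal; below.
Qed.

Lemma fresh_list G : exists N, forall A, In A G -> forall s s' r r',
  (forall i, i < N -> s i = s' i) -> (forall i, i < N -> r i = r' i) ->
  subst s r A = subst s' r' A.
Proof.
  induction G as [|A G [N IH]].
  - now exists 0.
  - destruct (fresh A) as [M H]; exists (N + M); intros B [->|HB] s s' r r' Hs Hr.
    + apply H; below.
    + apply (IH B HB); below.
Qed.

(** * Eigenvariables as meta-level variables *)

(** Undoes the naming of a bound variable by [n]: on formulas in which [n] is fresh it acts as a
    shift, and the variable [n] itself becomes index 0. *)
Definition to0N (n i : nat) : term := if Nat.eqb i n then Var 0 else Var (S i).
Definition to0F (n i : nat) : fterm := if Nat.eqb i n then FVar 0 else FVar (S i).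

Lemma to0N_lt n i : i < n -> to0N n i = Var (S i).
Proof. intro H; unfold to0N; destruct (Nat.eqb_spec i n); [lia|auto]. Qed.

Lemma to0F_lt n i : i < n -> to0F n i = FVar (S i).
Proof. intro H; unfold to0F; destruct (Nat.eqb_spec i n); [lia|auto]. Qed.

Lemma freshN G A : exists n,
  (forall B, In B G -> subst (to0N n) FVar B = shiftN B)
  /\ subst (to0N n) FVar (instN (Var n) A) = A.
Proof.
  destruct (fresh_list G) as [N HG], (fresh A) as [M HA].
  exists (N + M); split.
  - intros B HB; apply (HG B HB); auto; intros; apply to0N_lt; lia.
  - unfold instN; rewrite subst_comp.
    transitivity (subst Var FVar A); [|now apply subst_id].
    apply HA; auto; intros [|i] Hi; cbn.
    + unfold to0N; now rewrite Nat.eqb_refl.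
    + apply to0N_lt; lia.
Qed.

Lemma freshF G A : exists n,
  (forall B, In B G -> subst Var (to0F n) B = shiftF B)
  /\ subst Var (to0F n) (instF (FVar n) A) = A.
Proof.
  destruct (fresh_list G) as [N HG], (fresh A) as [M HA].
  exists (N + M); split.
  - intros B HB; apply (HG B HB); auto; intros; apply to0F_lt; lia.
  - unfold instF; rewrite subst_comp.
    transitivity (subst Var FVar A); [|now apply subst_id].
    apply HA; auto; intros [|i] Hi; cbn.
    + unfold to0F; now rewrite Nat.eqb_refl.
    + apply to0F_lt; lia.
Qed.

(* Substituting a fresh variable for [t] gives the premise of the eigenvariable
   rule.  The rules for [Imp], [Or] and [Ex] below quantify over all extensions
   [G'] of [G], so that assumptions become hypotheses [prv G' A]. *)
Lemma allN_intro G A : (forall t, prv G (instN t A)) -> prv G (AllN A).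
Proof.
  intro H; destruct (freshN G A) as [n [HG HA]]; apply prv_allNI.
  rewrite <- HA, <- (map_ext_in _ _ _ HG); apply prv_subst, H.
Qed.

Lemma allF_intro G A : (forall f, prv G (instF f A)) -> prv G (AllF A).
Proof.
  intro H; destruct (freshF G A) as [n [HG HA]]; apply prv_allFI.
  rewrite <- HA, <- (map_ext_in _ _ _ HG); apply prv_subst, H.
Qed.

Lemma imp_intro G A B :
  (forall G', incl G G' -> prv G' A -> prv G' B) -> prv G (Imp A B).
Proof.
  intro H; apply prv_impI, H; [now apply incl_tl|apply prv_hyp; now left].
Qed.

Lemma or_elim G A B C : prv G (Or A B) ->
  (forall G', incl G G' -> prv G' A -> prv G' C) ->
  (forall G', incl G G' -> prv G' B -> prv G' C) -> prv G C.
Proof.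
  intros H HA HB; apply prv_orE with A B; auto; [apply HA|apply HB];
    auto using incl_tl, incl_refl; apply prv_hyp; now left.
Qed.

Lemma exN_elim G A C : prv G (ExN A) ->
  (forall G', incl G G' -> forall t, prv G' (instN t A) -> prv G' C) -> prv G C.
Proof.
  (* [C] joins the list so that [n] is fresh for the conclusion too. *)
  intros HE H; destruct (freshN (C :: G) A) as [n [HG HA]].
  apply prv_exNE with A; auto.
  rewrite <- HA, <- (HG C) by now left.
  rewrite <- (map_ext_in (subst (to0N n) FVar)) by (intros; apply HG; now right).
  apply (prv_subst (instN (Var n) A :: G)), H with (t := Var n); auto using incl_tl, incl_refl.
  apply prv_hyp; now left.
Qed.

Lemma exF_elim G A C : prv G (ExF A) ->
  (forall G', incl G G' -> forall f, prv G' (instF f A) -> prv G' C) -> prv G C.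
Proof.
  intros HE H; destruct (freshF (C :: G) A) as [n [HG HA]].
  apply prv_exFE with A; auto.
  rewrite <- HA, <- (HG C) by now left.
  rewrite <- (map_ext_in (subst Var (to0F n))) by (intros; apply HG; now right).
  apply (prv_subst (instF (FVar n) A :: G)), H with (f := FVar n); auto using incl_tl, incl_refl.
  apply prv_hyp; now left.
Qed.

(** * Equational reasoning *)

Lemma tsubst_inst_shift t u :
  tsubst (fun i => match i with 0 => t | S j => Var j end) FVar (tshiftN u) = u.
Proof.
  unfold tshiftN; rewrite tsubst_comp; apply tsubst_id.
Qed.

Lemma fsubst_inst_shift f g :
  fsubst (fun i => match i with 0 => f | S j => FVar j end) (fshiftF g) = g.
Proof. now destruct g. Qed.

(** This equation and its analogues below serve as rewriting rules, so that instantiating a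
    quantifier leaves the abbreviations folded. *)
Lemma tsubst_Suc s r t : tsubst s r (Suc t) = Suc (tsubst s r t).
Proof. reflexivity. Qed.

Lemma tsubst_appc s r c t : tsubst s r (appc c t) = appc c (tsubst s r t).
Proof. reflexivity. Qed.

Lemma tsubst_add s r t u : tsubst s r (add t u) = add (tsubst s r t) (tsubst s r u).
Proof. reflexivity. Qed.

Lemma tsubst_ifz s r t u v :
  tsubst s r (ifz t u v) = ifz (tsubst s r t) (tsubst s r u) (tsubst s r v).
Proof. reflexivity. Qed.

Lemma tsubst_len s r a : tsubst s r (len a) = len (tsubst s r a).
Proof. reflexivity. Qed.

Lemma tsubst_entry s r a j :
  tsubst s r (entry a j) = entry (tsubst s r a) (tsubst s r j).
Proof. reflexivity. Qed.

Lemma subst_Not s r A : subst s r (Not A) = Not (subst s r A).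
Proof. reflexivity. Qed.

Lemma subst_Lt s r t u : subst s r (Lt t u) = Lt (tsubst s r t) (tsubst s r u).
Proof.
  unfold Lt; cbn [subst]; now rewrite tsubst_add, tsubst_Suc, !tsubst_upN_shift.
Qed.

Lemma subst_Bin s r a : subst s r (Bin a) = Bin (tsubst s r a).
Proof.
  unfold Bin; cbn [subst].
  rewrite subst_Lt, tsubst_len, !tsubst_entry, !tsubst_upN_shift; reflexivity.
Qed.

Lemma subst_Apart s r n a b :
  subst s r (Apart n a b) = Apart (tsubst s r n) (tsubst s r a) (tsubst s r b).
Proof.
  unfold Apart; cbn [subst].
  rewrite subst_Not, !subst_Lt; cbn [subst].
  rewrite !tsubst_len, !tsubst_entry, !tsubst_upN_shift; reflexivity.
Qed.

Lemma subst_Incr s r f : subst s r (Incr f) = Incr (fsubst r f).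
Proof.
  unfold Incr; cbn [subst]; rewrite subst_Lt; reflexivity.
Qed.

Global Hint Rewrite tsubst_inst_shift fsubst_inst_shift tsubst_upN_shift
  fsubst_upF_shift fsubst_id tsubst_appc
  tsubst_Suc tsubst_add tsubst_ifz
  tsubst_len tsubst_entry subst_Not subst_Lt subst_Bin subst_Apart subst_Incr : bim.

Ltac inst :=
  repeat progress
    (unfold instN, instF; cbn [subst tsubst fsubst upN upF]; autorewrite with bim).
Ltac inst_in H :=
  repeat progress
    (unfold instN, instF in H; cbn [subst tsubst fsubst upN upF] in H;
     autorewrite with bim in H).

(** * Provable equality as a congruence *)

(** A named relation for setoid rewriting; it is convertible with derivability of the equation, and
    [change] passes between the two. *)
Definition eqv (G : list form) (t u : term) : Prop := prv G (EqN t u).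

(* Given [I : incl G G'], weakens all hypotheses over [G] to [G']. *)
Ltac lift I :=
  match type of I with
  | incl ?G ?G' =>
      repeat match goal with
             | H : prv G _ |- _ => apply (prv_weaken _ _ _ I) in H
             | H : eqv G ?t ?u |- _ =>
                 apply (prv_weaken _ _ _ I) in H; change (eqv G' t u) in H
             | H : forall G1, incl G G1 -> _ |- _ =>
                 let H' := fresh in
                 pose proof (fun G1 I1 => H G1 (incl_tran I I1)) as H';
                 clear H; rename H' into H
             end
  end; clear I; cbv beta in *.

Lemma prv_rewrite G A t u : eqv G t u -> prv G (instN t A) -> prv G (instN u A).
Proof. apply prv_eqN_subst. Qed.

Lemma eqv_sym G t u : eqv G t u -> eqv G u t.
Proof.
  intro H; pose proof (prv_rewrite G (EqN (Var 0) (tshiftN t)) t u H) as H'.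
  inst_in H'; apply H', prv_eqN_refl.
Qed.

Lemma eqv_trans G t u v : eqv G t u -> eqv G u v -> eqv G t v.
Proof.
  intros H1 H2; pose proof (prv_rewrite G (EqN (tshiftN t) (Var 0)) u v H2) as H.
  inst_in H; now apply H.
Qed.

Global Instance eqv_equiv G : Equivalence (eqv G).
Proof.
  split; [intro; apply prv_eqN_refl|exact (eqv_sym G)|exact (eqv_trans G)].
Qed.

Global Instance App_proper G f : Proper (eqv G ==> eqv G) (App f).
Proof.
  intros t u H.
  pose proof (prv_rewrite G (EqN (App f (tshiftN t)) (App f (Var 0))) t u H) as H'.
  inst_in H'; apply H', prv_eqN_refl.
Qed.

Global Instance J_proper G : Proper (eqv G ==> eqv G ==> eqv G) J.
Proof.
  intros t u H t' u' H'; transitivity (J u t').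
  - pose proof (prv_rewrite G (EqN (J (tshiftN t) (tshiftN t')) (J (Var 0) (tshiftN t')))
                  t u H) as E.
    inst_in E; apply E, prv_eqN_refl.
  - pose proof (prv_rewrite G (EqN (J (tshiftN u) (tshiftN t')) (J (tshiftN u) (Var 0)))
                  t' u' H') as E.
    inst_in E; apply E, prv_eqN_refl.
Qed.

Ltac proper := unfold Proper, respectful; intros;
  repeat match goal with H : eqv _ _ _ |- _ => rewrite H; clear H end; reflexivity.

Global Instance appc_proper G c : Proper (eqv G ==> eqv G) (appc c).
Proof. unfold appc; proper. Qed.
Global Instance Suc_proper G : Proper (eqv G ==> eqv G) Suc.
Proof. unfold Suc; proper. Qed.
Global Instance pred_proper G : Proper (eqv G ==> eqv G) pred.
Proof. unfold pred; proper. Qed.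
Global Instance add_proper G : Proper (eqv G ==> eqv G ==> eqv G) add.
Proof. unfold add; proper. Qed.
Global Instance sub_proper G : Proper (eqv G ==> eqv G ==> eqv G) sub.
Proof. unfold sub; proper. Qed.
Global Instance iterL_proper G : Proper (eqv G ==> eqv G ==> eqv G) iterL.
Proof. unfold iterL; proper. Qed.
Global Instance ifz_proper G : Proper (eqv G ==> eqv G ==> eqv G ==> eqv G) ifz.
Proof. unfold ifz; proper. Qed.
Global Instance len_proper G : Proper (eqv G ==> eqv G) len.
Proof. unfold len; proper. Qed.
Global Instance entry_proper G : Proper (eqv G ==> eqv G ==> eqv G) entry.
Proof. unfold entry; cbv zeta; proper. Qed.

(** * Evaluation of the constants and of the functions defined from them *)

Lemma eq_cId G t : eqv G (appc cId t) t.
Proof. exact (prv_allNE G _ t (prv_ax G _ ax_id)). Qed.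

Lemma eq_cZero G t : eqv G (appc cZero t) Zero.
Proof. exact (prv_allNE G _ t (prv_ax G _ ax_zero)). Qed.

Lemma eq_cK G t u : eqv G (appc cK (J t u)) t.
Proof.
  pose proof (prv_allNE G _ u (prv_allNE G _ t (prv_ax G _ ax_K))) as H; inst_in H; exact H.
Qed.

Lemma eq_cL G t u : eqv G (appc cL (J t u)) u.
Proof.
  pose proof (prv_allNE G _ u (prv_allNE G _ t (prv_ax G _ ax_L))) as H; inst_in H; exact H.
Qed.

Lemma eq_cComp G f g t : eqv G (appc (cComp f g) t) (appc f (appc g t)).
Proof. exact (prv_allNE G _ t (prv_ax G _ (ax_cComp f g))). Qed.

Lemma eq_cPair G f g t : eqv G (appc (cPair f g) t) (J (appc f t) (appc g t)).
Proof. exact (prv_allNE G _ t (prv_ax G _ (ax_cPair f g))). Qed.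

Lemma eq_cRec0 G f g t : eqv G (appc (cRec f g) (J t Zero)) (appc f t).
Proof. exact (prv_allNE G _ t (prv_ax G _ (ax_cRec0 f g))). Qed.

Lemma eq_cRecS G f g t u :
  eqv G (appc (cRec f g) (J t (Suc u)))
        (appc g (J (J t u) (appc (cRec f g) (J t u)))).
Proof.
  pose proof (prv_allNE G _ u (prv_allNE G _ t (prv_ax G _ (ax_cRecS f g)))) as H;
  inst_in H; exact H.
Qed.

Ltac compute_const :=
  repeat progress rewrite ?eq_cId, ?eq_cZero, ?eq_cComp, ?eq_cPair, ?eq_cK, ?eq_cL,
    ?eq_cRec0, ?eq_cRecS; try reflexivity.

Lemma add_0r G t : eqv G (add t Zero) t.
Proof. unfold add; compute_const. Qed.

Lemma add_Sr G t u : eqv G (add t (Suc u)) (Suc (add t u)).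
Proof. unfold add, Suc at 2; rewrite eq_cRecS; compute_const. Qed.

Lemma pred_S G t : eqv G (pred (Suc t)) t.
Proof. unfold pred; compute_const. Qed.

Lemma sub_0r G t : eqv G (sub t Zero) t.
Proof. unfold sub; compute_const. Qed.

Lemma iterL_0r G t : eqv G (iterL t Zero) t.
Proof. unfold iterL; compute_const. Qed.

Lemma ifz_0 G t u : eqv G (ifz Zero t u) t.
Proof. unfold ifz; compute_const. Qed.

Lemma ifz_S G t u v : eqv G (ifz (Suc t) u v) v.
Proof. unfold ifz; compute_const. Qed.

(** * Arithmetic *)

Lemma not_elim G A C : prv G (Not A) -> prv G A -> prv G C.
Proof. intros H HA; apply prv_botE, prv_impE with A; auto. Qed.

(** [P] presents the induction formula as a function of terms, so that only the equation tying it to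
    [A] involves de Bruijn indices. *)
Lemma induction G A (P : term -> form) :
  (forall t, instN t A = P t) ->
  prv G (P Zero) ->
  (forall G', incl G G' -> forall t, prv G' (P t) -> prv G' (P (Suc t))) ->
  forall t, prv G (P t).
Proof.
  intros E H0 HS t; rewrite <- E.
  apply prv_allNE; eapply prv_impE; [apply prv_ax, ax_induction|].
  apply prv_andI; [now rewrite E|].
  apply allN_intro; intro u; apply imp_intro; fold subst; intros G' I H.
  (* The successor form of [A], instantiated at [u], is [A] at [Suc u]. *)
  replace (subst _ FVar (subst _ FVar A)) with (instN (Suc u) A).
  - rewrite E; apply HS; auto; rewrite <- E; exact H.
  - unfold instN; rewrite subst_comp; apply subst_ext; [now intros [|i]|reflexivity].
Qed.

(** Proved by an induction whose step ignores the induction hypothesis. It makes equality with zero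
    decidable, and all later case distinctions on values rest on it. *)
Lemma zero_or_succ G t C :
  (forall G', incl G G' -> eqv G' t Zero -> prv G' C) ->
  (forall G', incl G G' -> forall u, eqv G' t (Suc u) -> prv G' C) -> prv G C.
Proof.
  intros H0 HS.
  apply or_elim with (EqN t Zero) (ExN (EqN (tshiftN t) (Suc (Var 0)))); auto.
  - apply (induction G (Or (EqN (Var 0) Zero) (ExN (EqN (Var 1) (Suc (Var 0)))))
             (fun t => Or (EqN t Zero) (ExN (EqN (tshiftN t) (Suc (Var 0))))));
      clear; [now intro; inst|..].
    + apply prv_orI1, prv_eqN_refl.
    + intros G' _ t _; apply prv_orI2.
      apply prv_exNI with t; inst; apply prv_eqN_refl.
  - intros G' I H; lift I; apply (exN_elim _ _ _ H); intros G1 I u E; inst_in E; lift I.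
    eauto using incl_refl.
Qed.

Lemma Suc_neq0 G t C : eqv G (Suc t) Zero -> prv G C.
Proof. apply not_elim, (prv_allNE G _ t (prv_ax G _ ax_succ_neq0)). Qed.

Lemma Suc_inj G t u : eqv G (Suc t) (Suc u) -> eqv G t u.
Proof.
  pose proof (prv_allNE G _ u (prv_allNE G _ t (prv_ax G _ ax_succ_inj))) as H;
  inst_in H; apply (prv_impE _ _ _ H).
Qed.

Lemma add_0l G t : eqv G (add Zero t) t.
Proof.
  apply (induction G (EqN (add Zero (Var 0)) (Var 0)) (fun t => EqN (add Zero t) t));
    clear; [now intro; inst|..].
  - apply add_0r.
  - intros G' _ u E; change (eqv G' (add Zero u) u) in E.
    change (eqv G' (add Zero (Suc u)) (Suc u)); now rewrite add_Sr, E.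
Qed.

Lemma add_Sl G t u : eqv G (add (Suc t) u) (Suc (add t u)).
Proof.
  apply (induction G (EqN (add (Suc (tshiftN t)) (Var 0)) (Suc (add (tshiftN t) (Var 0))))
           (fun u => EqN (add (Suc t) u) (Suc (add t u)))); clear; [now intro; inst|..].
  - change (eqv G (add (Suc t) Zero) (Suc (add t Zero))); now rewrite !add_0r.
  - intros G' _ u E; change (eqv G' (add (Suc t) u) (Suc (add t u))) in E.
    change (eqv G' (add (Suc t) (Suc u)) (Suc (add t (Suc u)))); now rewrite !add_Sr, E.
Qed.

Lemma add_assoc G t u v : eqv G (add (add t u) v) (add t (add u v)).
Proof.
  apply (induction G (EqN (add (add (tshiftN t) (tshiftN u)) (Var 0))
                          (add (tshiftN t) (add (tshiftN u) (Var 0))))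
           (fun v => EqN (add (add t u) v) (add t (add u v)))); clear; [now intro; inst|..].
  - change (eqv G (add (add t u) Zero) (add t (add u Zero))); now rewrite !add_0r.
  - intros G' _ v E; change (eqv G' (add (add t u) v) (add t (add u v))) in E.
    change (eqv G' (add (add t u) (Suc v)) (add t (add u (Suc v)))).
    now rewrite !add_Sr, E.
Qed.

(** Irreflexivity of [Lt] with its witness [u] unpacked; by induction on [t], cancelling
    successors. *)
Lemma add_succ_neq G t u C : eqv G t (add t (Suc u)) -> prv G C.
Proof.
  apply not_elim.
  apply (induction G (Not (EqN (Var 0) (add (Var 0) (Suc (tshiftN u)))))
           (fun t => Not (EqN t (add t (Suc u))))); clear; [now intro; inst|..].
  - apply imp_intro; intros G' _ E; fold (eqv G' Zero (add Zero (Suc u))) in E.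
    rewrite add_0l in E; symmetry in E; exact (Suc_neq0 _ _ _ E).
  - intros G' _ t IH; apply imp_intro; intros G1 I E; lift I.
    fold (eqv G1 (Suc t) (add (Suc t) (Suc u))) in E.
    rewrite add_Sl in E; exact (not_elim _ _ _ IH (Suc_inj _ _ _ E)).
Qed.

(** * The strict order and increasing functions *)

Lemma Lt_intro G t u v : eqv G (add t (Suc v)) u -> prv G (Lt t u).
Proof. intro H; apply prv_exNI with v; inst; exact H. Qed.

Lemma Lt_elim G t u C : prv G (Lt t u) ->
  (forall G', incl G G' -> forall v, eqv G' (add t (Suc v)) u -> prv G' C) -> prv G C.
Proof.
  intros H K; apply (exN_elim _ _ _ H); intros G' I v E; inst_in E; eauto.
Qed.

Lemma Lt_rewrite G t t' u u' :
  eqv G t t' -> eqv G u u' -> prv G (Lt t u) -> prv G (Lt t' u').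
Proof.
  intros E E' H; apply (Lt_elim _ _ _ _ H); intros G' I v Ev; lift I.
  apply Lt_intro with v; now rewrite <- E, <- E'.
Qed.

Lemma Lt_0_Suc G t : prv G (Lt Zero (Suc t)).
Proof. apply Lt_intro with t, add_0l. Qed.

(** The gain of one over plain transitivity drives the induction that bounds an increasing function
    from below. *)
Lemma Lt_trans_Suc G t u v : prv G (Lt t u) -> prv G (Lt u v) -> prv G (Lt (Suc t) v).
Proof.
  intros H1 H2; apply (Lt_elim _ _ _ _ H1); intros G1 I x E; lift I.
  apply (Lt_elim _ _ _ _ H2); intros G2 I y E'; lift I.
  apply Lt_intro with (add x y).
  rewrite <- E', <- E, add_Sl, !add_Sr, add_Sl, add_assoc; reflexivity.
Qed.

Lemma not_Lt_0 G t C : prv G (Lt t Zero) -> prv G C.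
Proof.
  intro H; apply (Lt_elim _ _ _ _ H); intros G1 I x E.
  rewrite add_Sr in E; exact (Suc_neq0 _ _ _ E).
Qed.

Lemma Incr_elim G f t : prv G (Incr f) -> prv G (Lt (App f t) (App f (Suc t))).
Proof. intro H; apply prv_allNE with (t := t) in H; inst_in H; exact H. Qed.

(** The argument is [Suc t] because [f] may start at 0. Consequently a search below [f(t+1)] reaches
    [t]. *)
Lemma Incr_Lt G f t : prv G (Incr f) -> prv G (Lt t (App f (Suc t))).
Proof.
  intro Hf.
  apply (induction G (Lt (Var 0) (App f (Suc (Var 0)))) (fun t => Lt t (App f (Suc t))));
    [now intro; inst|..].
  - apply (Lt_elim _ _ _ _ (Incr_elim _ _ Zero Hf)); intros G1 I x E; lift I.
    apply Lt_intro with (add (App f Zero) x); now rewrite add_0l, <- add_Sr.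
  - intros G1 I u IH; lift I; exact (Lt_trans_Suc _ _ _ _ IH (Incr_elim _ _ _ Hf)).
Qed.

(** * Finite sequences *)

Lemma Bin_intro G a :
  (forall G', incl G G' -> forall j, prv G' (Lt j (len a)) ->
     prv G' (Or (EqN (entry a j) Zero) (EqN (entry a j) One))) ->
  prv G (Bin a).
Proof. intro K; apply allN_intro; intro j; inst; apply imp_intro; auto. Qed.

Lemma Bin_elim G a j C : prv G (Bin a) -> prv G (Lt j (len a)) ->
  (forall G', incl G G' -> eqv G' (entry a j) Zero -> prv G' C) ->
  (forall G', incl G G' -> eqv G' (entry a j) One -> prv G' C) -> prv G C.
Proof.
  intros Ha Hj H0 H1; apply prv_allNE with (t := j) in Ha; inst_in Ha.
  exact (or_elim _ _ _ _ (prv_impE _ _ _ Ha Hj) H0 H1).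
Qed.

Lemma Apart_intro G n a b j :
  prv G (Lt j n) -> prv G (Lt j (len a)) -> prv G (Lt j (len b)) ->
  (forall G', incl G G' -> eqv G' (entry a j) (entry b j) -> prv G' Bot) ->
  prv G (Apart n a b).
Proof.
  intros Hn Ha Hb H; apply prv_exNI with j; inst.
  repeat apply prv_andI; auto; apply imp_intro; exact H.
Qed.

Lemma Apart_elim G n a b C : prv G (Apart n a b) ->
  (forall G', incl G G' -> forall j,
     prv G' (Lt j n) -> prv G' (Lt j (len a)) -> prv G' (Lt j (len b)) ->
     prv G' (Not (EqN (entry a j) (entry b j))) -> prv G' C) -> prv G C.
Proof.
  intros H K; apply (exN_elim _ _ _ H); intros G' I j E; inst_in E.
  apply (K G' I j); eauto using prv_andE1, prv_andE2.
Qed.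

Lemma Bin_rewrite G a a' : eqv G a a' -> prv G (Bin a) -> prv G (Bin a').
Proof.
  intros E H; pose proof (prv_rewrite G (Bin (Var 0)) a a' E) as K.
  inst_in K; auto.
Qed.

Lemma Apart_rewrite G n a a' b b' :
  eqv G a a' -> eqv G b b' -> prv G (Apart n a b) -> prv G (Apart n a' b').
Proof.
  intros E E' H; apply (Apart_elim _ _ _ _ _ H); intros G' I j Hn Ha Hb Hj; lift I.
  assert (El : eqv G' (len a) (len a')) by now rewrite E.
  assert (El' : eqv G' (len b) (len b')) by now rewrite E'.
  apply Apart_intro with j; eauto using Lt_rewrite, prv_eqN_refl.
  - apply (Lt_rewrite _ j j (len a)); auto; reflexivity.
  - apply (Lt_rewrite _ j j (len b)); auto; reflexivity.
  - intros G1 I Ej; lift I; apply (not_elim _ _ _ Hj).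
    change (eqv G1 (entry a j) (entry b j)); now rewrite E, E'.
Qed.

Lemma Apart_sym G n a b : prv G (Apart n a b) -> prv G (Apart n b a).
Proof.
  intros H; apply (Apart_elim _ _ _ _ _ H); intros G' I j Hn Ha Hb Hj.
  apply Apart_intro with j; auto; intros G1 I1 E; lift I1.
  apply (not_elim _ _ _ Hj), eqv_sym, E.
Qed.

Lemma Bin_Zero G : prv G (Bin Zero).
Proof.
  apply Bin_intro; intros G' I j H; apply (not_Lt_0 G' j).
  refine (Lt_rewrite _ _ _ _ _ _ _ H); [reflexivity|apply ifz_0].
Qed.

(* The code of the sequence of length 1 with entry [t]. *)
Definition single (t : term) : term := Suc (J Zero t).

Lemma len_single G t : eqv G (len (single t)) One.
Proof. unfold len, single; rewrite ifz_S, pred_S, eq_cK; reflexivity. Qed.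

Lemma entry_single G t : eqv G (entry (single t) Zero) t.
Proof.
  unfold entry, single; cbv zeta; rewrite pred_S, eq_cK, eq_cL, sub_0r, ifz_0.
  apply iterL_0r.
Qed.

Lemma tsubst_single s r t : tsubst s r (single t) = single (tsubst s r t).
Proof. reflexivity. Qed.

Global Hint Rewrite tsubst_single : bim.

Global Instance single_proper G : Proper (eqv G ==> eqv G) single.
Proof. unfold single; proper. Qed.

(** * Definable functions *)

(** Only numerical variables are restricted; function variables may occur as parameters. *)
Fixpoint only_Var0 (t : term) : Prop :=
  match t with
  | Var 0 | Zero => True
  | Var (S _) => False
  | J t u => only_Var0 t /\ only_Var0 u
  | App _ t => only_Var0 t
  end.

Lemma value G f t x : prv G (AllN (EqN (App f (Var 0)) t)) ->
  eqv G (App f x) (tsubst (fun i => match i with 0 => x | S j => Var j end) FVar t).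
Proof.
  intro H; apply prv_allNE with (t := x) in H; unfold instN in H; cbn [subst tsubst] in H.
  rewrite fsubst_id in H; exact H.
Qed.

Lemma value_intro G f t :
  (forall x, eqv G (App f x)
     (tsubst (fun i => match i with 0 => x | S j => Var j end) FVar t)) ->
  prv G (AllN (EqN (App f (Var 0)) t)).
Proof.
  intro H; apply allN_intro; intro x; unfold instN; cbn [subst tsubst].
  rewrite fsubst_id; apply H.
Qed.

Lemma comprehension t : only_Var0 t -> forall G C,
  (forall G', incl G G' -> forall f,
     prv G' (AllN (EqN (App f (Var 0)) t)) -> prv G' C) -> prv G C.
Proof.
  induction t as [[|i]| |t IHt u IHu|f t IHt]; cbn [only_Var0]; intros Ht G C K.
  - exact (K G (incl_refl G) (FConst cId) (prv_ax G _ ax_id)).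
  - destruct Ht.
  - exact (K G (incl_refl G) (FConst cZero) (prv_ax G _ ax_zero)).
  - destruct Ht as [Ht Hu].
    apply (IHt Ht); intros G1 I f Hf; lift I.
    apply (IHu Hu); intros G2 I g Hg; lift I.
    pose proof (prv_allFE _ _ g (prv_allFE _ _ f (prv_ax G2 _ ax_pair))) as H; inst_in H.
    apply (exF_elim _ _ _ H); intros G3 I h Hh; inst_in Hh; lift I.
    apply (K _ (incl_refl _) h), value_intro; intro x; cbn [tsubst].
    rewrite <- (value _ _ _ x Hf), <- (value _ _ _ x Hg).
    pose proof (value _ _ _ x Hh) as E; inst_in E; exact E.
  - apply (IHt Ht); intros G1 I g Hg; lift I.
    pose proof (prv_allFE _ _ g (prv_allFE _ _ f (prv_ax G1 _ ax_comp))) as H; inst_in H.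
    apply (exF_elim _ _ _ H); intros G3 I h Hh; inst_in Hh; lift I.
    apply (K _ (incl_refl _) h), value_intro; intro x; cbn [tsubst].
    rewrite <- (value _ _ _ x Hg).
    pose proof (value _ _ _ x Hh) as E; inst_in E; rewrite fsubst_id; exact E.
Qed.

Definition nonzero (t : term) : form := Not (EqN t Zero).

Lemma nonzero_intro G t u : eqv G t (Suc u) -> prv G (nonzero t).
Proof.
  intro E; apply imp_intro; intros G' I E'; lift I.
  change (eqv G' t Zero) in E'; rewrite E in E'; exact (Suc_neq0 _ _ _ E').
Qed.

(** The negation yields a predecessor because equality with zero is decidable. *)
Lemma nonzero_elim G t C : prv G (nonzero t) ->
  (forall G', incl G G' -> forall u, eqv G' t (Suc u) -> prv G' C) -> prv G C.
Proof.
  intros H K; apply (zero_or_succ _ t); auto.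
  intros G' I E; lift I; exact (not_elim _ _ _ H E).
Qed.

Lemma nonzero_rewrite G t u : eqv G t u -> prv G (nonzero t) -> prv G (nonzero u).
Proof.
  intros E H; apply (nonzero_elim _ _ _ H); intros G' I v Ev; lift I.
  apply nonzero_intro with v; now rewrite <- E.
Qed.

Lemma subst_nonzero s r t : subst s r (nonzero t) = nonzero (tsubst s r t).
Proof. reflexivity. Qed.

Global Hint Rewrite subst_nonzero : bim.

(** * Bounded search *)

(* [h(a,j) = 0] iff [p(a,i) = 0] for all [i < j]. *)
Definition Search (h p : fterm) : form :=
  And (AllN (EqN (App h (J (Var 0) Zero)) Zero))
      (AllN (AllN (EqN (App h (J (Var 1) (Suc (Var 0))))
         (ifz (App h (J (Var 1) (Var 0))) (App p (J (Var 1) (Var 0))) One)))).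

Lemma search_exists G p C :
  (forall G', incl G G' -> forall h, prv G' (Search h p) -> prv G' C) -> prv G C.
Proof.
  intro K.
  (* The step function of the recursion receives [J (J m n) v] with [v] the previous value: [cL]
     reads off [v], and [cK] the pair to which [p] is applied. *)
  apply (comprehension (ifz (appc cL (Var 0)) (App p (appc cK (Var 0))) One));
    [cbn; tauto|]; intros G1 I g Hg; lift I.
  pose proof (prv_allFE _ _ g (prv_allFE _ _ (FConst cZero) (prv_ax G1 _ ax_rec))) as H.
  inst_in H; apply (exF_elim _ _ _ H); clear H; intros G2 I h H; inst_in H; lift I.
  assert (E : forall m n, eqv G2 (App h (J m Zero)) Zero /\
      eqv G2 (App h (J m (Suc n))) (ifz (App h (J m n)) (App p (J m n)) One)).
  { intros m n; pose proof (prv_allNE _ _ n (prv_allNE _ _ m H)) as E; inst_in E; split.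
    - transitivity (appc cZero m); [exact (prv_andE1 _ _ _ E)|apply eq_cZero].
    - apply prv_andE2 in E.
      pose proof (value _ _ _ (J (J m n) (App h (J m n))) Hg) as E'; inst_in E'.
      rewrite eq_cK, eq_cL in E'; rewrite <- E'; exact E. }
  apply (K _ (incl_refl _) h), prv_andI; apply allN_intro; intro m; inst.
  - apply (E m Zero).
  - apply allN_intro; intro n; inst; apply (E m n).
Qed.

Lemma search_0 h p a G : prv G (Search h p) -> eqv G (App h (J a Zero)) Zero.
Proof.
  intro H; apply prv_andE1, (prv_allNE _ _ a) in H; inst_in H; exact H.
Qed.

Lemma search_S h p a G j : prv G (Search h p) ->
  eqv G (App h (J a (Suc j))) (ifz (App h (J a j)) (App p (J a j)) One).
Proof.
  intro H; apply prv_andE2, (prv_allNE _ _ a), (prv_allNE _ _ j) in H; inst_in H; exact H.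
Qed.

Lemma search_S_nonzero_l h p a G j : prv G (Search h p) ->
  prv G (nonzero (App h (J a j))) -> prv G (nonzero (App h (J a (Suc j)))).
Proof.
  intros H Hj; apply (nonzero_elim _ _ _ Hj); intros G1 I u E; lift I.
  apply nonzero_intro with Zero; now rewrite (search_S h p), E, ifz_S.
Qed.

Lemma search_S_nonzero_r h p a G j : prv G (Search h p) ->
  prv G (nonzero (App p (J a j))) -> prv G (nonzero (App h (J a (Suc j)))).
Proof.
  intros H Hj; apply (zero_or_succ _ (App h (J a j))); intros G1 I; lift I; [intro E|intros u E].
  - apply nonzero_rewrite with (App p (J a j)); auto; now rewrite (search_S h p), E, ifz_0.
  - apply (search_S_nonzero_l _ p), nonzero_intro with u; auto.
Qed.

Lemma search_add h p a G j x : prv G (Search h p) ->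
  prv G (nonzero (App h (J a j))) -> prv G (nonzero (App h (J a (add j x)))).
Proof.
  intros H Hj.
  apply (induction G (nonzero (App h (J (tshiftN a) (add (tshiftN j) (Var 0)))))
           (fun x => nonzero (App h (J a (add j x))))); [now intro; inst|..].
  - apply nonzero_rewrite with (App h (J a j)); auto; now rewrite add_0r.
  - intros G1 I u IH; lift I.
    apply nonzero_rewrite with (App h (J a (Suc (add j u)))); [now rewrite add_Sr|].
    now apply (search_S_nonzero_l _ p).
Qed.

Lemma search_mono h p a G j k : prv G (Search h p) -> prv G (Lt j k) ->
  prv G (nonzero (App h (J a j))) -> prv G (nonzero (App h (J a k))).
Proof.
  intros H L Hj; apply (Lt_elim _ _ _ _ L); intros G1 I x E; lift I.
  apply nonzero_rewrite with (App h (J a (add j (Suc x)))); [now rewrite E|].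
  now apply (search_add _ p).
Qed.

Lemma search_complete h p a G i j : prv G (Search h p) -> prv G (Lt i j) ->
  prv G (nonzero (App p (J a i))) -> prv G (nonzero (App h (J a j))).
Proof.
  intros H L Hi; apply (Lt_elim _ _ _ _ L); intros G1 I x E; lift I.
  (* Here [j = i+1+x]: the search succeeds at [i+1] and remains successful for [x] further steps. *)
  apply nonzero_rewrite with (App h (J a (add (Suc i) x))).
  - now rewrite <- E, add_Sl, add_Sr.
  - apply (search_add _ p); auto; now apply (search_S_nonzero_r _ p).
Qed.

Lemma search_sound h p a G j C : prv G (Search h p) ->
  prv G (nonzero (App h (J a j))) ->
  (forall G', incl G G' -> forall i, prv G' (Lt i j) ->
     prv G' (nonzero (App p (J a i))) -> prv G' C) -> prv G C.
Proof.
  intros H Hj K.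
  apply (exN_elim _ (And (Lt (Var 0) (tshiftN j)) (nonzero (App p (J (tshiftN a) (Var 0)))))).
  (* Success of the search at [j] is moved into the induction formula, since it varies with the
     bound. *)
  - apply prv_impE with (nonzero (App h (J a j))); auto; clear Hj K.
    apply (induction G
      (Imp (nonzero (App h (J (tshiftN a) (Var 0))))
           (ExN (And (Lt (Var 0) (Var 1)) (nonzero (App p (J (tshiftN (tshiftN a)) (Var 0)))))))
      (fun j => Imp (nonzero (App h (J a j)))
         (ExN (And (Lt (Var 0) (tshiftN j)) (nonzero (App p (J (tshiftN a) (Var 0))))))));
      [now intro; inst|..].
    + apply imp_intro; intros G1 I H0; lift I.
      exact (not_elim _ _ _ H0 (search_0 _ _ _ _ H)).
    + intros G1 I u IH; lift I; apply imp_intro; intros G2 I Hu; lift I.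
      (* If [h] vanishes at [u], its value at [u+1] is that of [p] at [u], so [u] is the witness;
         otherwise the induction hypothesis supplies one below [u]. *)
      apply (zero_or_succ _ (App h (J a u))); intros G3 I; lift I; [intro E|intros v E].
      * apply prv_exNI with u; inst; apply prv_andI.
        -- apply Lt_intro with Zero; now rewrite add_Sr, add_0r.
        -- apply nonzero_rewrite with (App h (J a (Suc u))); auto.
           now rewrite (search_S h p), E, ifz_0.
      * assert (Hn : prv G3 (nonzero (App h (J a u)))) by eauto using nonzero_intro.
        apply (exN_elim _ _ _ (prv_impE _ _ _ IH Hn)); intros G4 I i Hi; inst_in Hi; lift I.
        apply prv_exNI with i; inst; apply prv_andI; eauto using prv_andE2.
        apply (Lt_elim _ _ _ _ (prv_andE1 _ _ _ Hi)); intros G5 I w Ew; lift I.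
        apply Lt_intro with (Suc w); now rewrite add_Sr, Ew.
  - intros G1 I i Hi; inst_in Hi; lift I.
    eauto using incl_refl, prv_andE1, prv_andE2.
Qed.

(** * The two implications *)

(** The sequences differ at position 0, which counts only if [n] is positive. *)
Lemma Apart_single G n x y :
  prv G (Lt x y) -> prv G (Lt Zero n) ->
  prv G (Apart n (single x) (single y)).
Proof.
  intros Hxy Hn; apply Apart_intro with Zero; auto;
    try (apply Lt_rewrite with Zero One; try reflexivity;
         [symmetry; apply len_single|apply Lt_0_Suc]).
  intros G1 I E; lift I; rewrite !entry_single in E.
  apply (Lt_elim _ _ _ _ Hxy); intros G2 I u Eu; lift I.
  apply (add_succ_neq _ x u); now rewrite Eu.
Qed.

Lemma Contr_BW_to_SC_C G : prv G Contr_BW -> prv G SC_C.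
Proof.
  intro HC; apply allF_intro; intro alpha; apply allF_intro; intro gamma; inst.
  apply imp_intro; intros G1 I HB; lift I; apply imp_intro; intros G2 I HS; lift I.
  (* [alpha] is presented as a predicate of pairs, as the search expects; the parameter is kept at
     [Zero] throughout. *)
  apply (comprehension (App alpha (appc cL (Var 0)))); [exact Logic.I|].
  intros G3 I p Hp; lift I.
  apply (search_exists _ p); intros G4 I h Hh; lift I.
  apply (comprehension (ifz (App h (J Zero (Var 0))) (App gamma (Var 0))
                            (single (Var 0)))); [cbn; tauto|].
  intros G5 I gamma' Hg; lift I.
  assert (Ep : forall G6, incl G5 G6 -> forall n,
                 eqv G6 (App p (J Zero n)) (App alpha n)).
  { intros G6 I n; lift I; pose proof (value _ _ _ (J Zero n) Hp) as E; inst_in E.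
    now rewrite E, eq_cL. }
  assert (Eg0 : forall G6, incl G5 G6 -> forall n, eqv G6 (App h (J Zero n)) Zero ->
                  eqv G6 (App gamma' n) (App gamma n)).
  { intros G6 I n E0; lift I; pose proof (value _ _ _ n Hg) as E; inst_in E.
    now rewrite E, E0, ifz_0. }
  assert (EgS : forall G6, incl G5 G6 -> forall n, prv G6 (nonzero (App h (J Zero n))) ->
                  eqv G6 (App gamma' n) (single n)).
  { intros G6 I n En; lift I; pose proof (value _ _ _ n Hg) as E; inst_in E.
    apply (nonzero_elim _ _ _ En); intros G7 I u Eu; lift I.
    change (eqv G7 (App gamma' n) (single n)).
    now rewrite E, Eu, ifz_S. }
  clear Hp Hg.
  apply (prv_allFE _ _ gamma') in HC; inst_in HC.
  eapply exN_elim; [apply (prv_impE _ _ _ HC); clear HC|].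
  - apply allF_intro; intro zeta; inst; apply imp_intro; intros G6 I Hz; lift I.
    assert (K : forall G7, incl G6 G7 -> forall n,
               prv G7 (nonzero (App h (J Zero (App zeta (Suc n))))) ->
               prv G7 (ExN (Apart (Var 0) (App gamma' (App zeta (Var 0)))
                                  (App gamma' (App zeta (Suc (Var 0))))))).
    (* The search has succeeded at [zeta(n+1)], hence also at [zeta(n+2)], so both values are
       one-term sequences; taking [Suc n] as witness puts position 0 below it. *)
    { intros G7 I n Hn; lift I; apply prv_exNI with (Suc n); inst.
      pose proof (Incr_elim _ _ (Suc n) Hz) as L.
      eapply Apart_rewrite; [symmetry; apply EgS|symmetry; apply EgS|];
        eauto using incl_refl, search_mono, Apart_single, Lt_0_Suc. }
    apply (prv_allFE _ _ zeta) in HS; inst_in HS.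
    apply (exN_elim _ _ _ (prv_impE _ _ _ HS Hz)); intros G7 I n Hn; inst_in Hn; lift I.
    apply (or_elim _ _ _ _ Hn); clear Hn; intros G8 I Hn; lift I.
    + apply (zero_or_succ _ (App h (J Zero (App zeta (Suc n))))); intros G9 I;
        [intro E1|intros u E1]; lift I; [|eauto using incl_refl, nonzero_intro].
      apply (zero_or_succ _ (App h (J Zero (App zeta n)))); intros G10 I;
        [intro E0|intros u E0]; lift I.
      (* Both values are those of [gamma]; the two principles list the sequences in opposite
         orders. *)
      * apply prv_exNI with n; inst; apply Apart_sym.
        eapply Apart_rewrite; [symmetry; apply Eg0|symmetry; apply Eg0|];
          eauto using incl_refl.
      * apply K with n; [apply incl_refl|].
        eauto using search_mono, Incr_elim, nonzero_intro.
    + apply K with n; [apply incl_refl|].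
      (* The search below [zeta(n+1)] finds [n], as [n < zeta(n+1)]. *)
      apply (search_complete _ p) with n; auto using Incr_Lt.
      apply nonzero_rewrite with (App alpha n); auto.
      symmetry; apply Ep, incl_refl.
  - intros G6 I n Hn; inst_in Hn; lift I.
    (* An unsuccessful search would give [gamma'(n) = gamma(n)], which is in [Bin]; a successful one
       yields the required argument of [alpha]. *)
    apply (zero_or_succ _ (App h (J Zero n))); intros G7 I; [intro E|intros u E]; lift I.
    + apply (not_elim _ _ _ Hn), Bin_rewrite with (App gamma n).
      * symmetry; apply Eg0; auto using incl_refl.
      * apply (prv_allNE _ _ n) in HB; inst_in HB; exact HB.
    + apply (search_sound h p Zero _ n); eauto using nonzero_intro.
      intros G8 I i _ Hi; lift I; apply prv_exNI with i; inst.
      apply nonzero_rewrite with (App p (J Zero i)); auto; apply Ep, incl_refl.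
Qed.

(* Vanishes exactly for [e = 0] and [e = 1]. *)
Definition not_bit (e : term) : term := ifz e Zero (ifz (pred e) Zero One).

Lemma tsubst_not_bit s r e : tsubst s r (not_bit e) = not_bit (tsubst s r e).
Proof. reflexivity. Qed.

Global Hint Rewrite tsubst_not_bit : bim.

Global Instance not_bit_proper G : Proper (eqv G ==> eqv G) not_bit.
Proof. unfold not_bit; proper. Qed.

Lemma not_bit_0 G : eqv G (not_bit Zero) Zero.
Proof. unfold not_bit; apply ifz_0. Qed.

Lemma not_bit_1 G : eqv G (not_bit One) Zero.
Proof. unfold not_bit, One; rewrite ifz_S, pred_S; apply ifz_0. Qed.

(** Two case distinctions, on [e] and on its predecessor, separate 0, 1 and larger values, so a
    refutation of the last case is enough for the disjunction. *)
Lemma not_bit_elim G e :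
  (forall G', incl G G' -> prv G' (nonzero (not_bit e)) -> prv G' Bot) ->
  prv G (Or (EqN e Zero) (EqN e One)).
Proof.
  intro K; apply (zero_or_succ _ e); intros G1 I; [intro E|intros u E]; lift I.
  - now apply prv_orI1.
  - apply (zero_or_succ _ u); intros G2 I; [intro E'|intros v E']; lift I.
    + apply prv_orI2; change (eqv G2 e One); now rewrite E, E'.
    + apply prv_botE, (K _ (incl_refl _)), nonzero_intro with Zero.
      unfold not_bit; now rewrite E, ifz_S, E', pred_S, ifz_S.
Qed.

(** [b(a)] is the result of searching below the length of [a] for an entry that is not a bit.
    Completeness of the search shows that [a] is in [Bin] when [b(a) = 0], and soundness refutes it
    when [b(a)] is nonzero. *)
Lemma Bin_decider G C :
  (forall G', incl G G' -> forall b,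
     (forall G1, incl G' G1 -> forall a, eqv G1 (App b a) Zero -> prv G1 (Bin a)) ->
     (forall G1, incl G' G1 -> forall a,
        prv G1 (nonzero (App b a)) -> prv G1 (Bin a) -> prv G1 Bot) ->
     prv G' C) -> prv G C.
Proof.
  intro K.
  apply (comprehension (not_bit (entry (appc cK (Var 0)) (appc cL (Var 0)))));
    [cbn; tauto|]; intros G1 I p Hp; lift I.
  apply (search_exists _ p); intros G2 I h Hh; lift I.
  apply (comprehension (App h (J (Var 0) (len (Var 0))))); [cbn; tauto|].
  intros G3 I b Hb; lift I.
  assert (Eb : forall G4, incl G3 G4 -> forall a,
                 eqv G4 (App b a) (App h (J a (len a)))).
  { intros G4 I a; lift I; pose proof (value _ _ _ a Hb) as E; inst_in E; exact E. }
  assert (Ep : forall G4, incl G3 G4 -> forall a j,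
                 eqv G4 (App p (J a j)) (not_bit (entry a j))).
  { intros G4 I a j; lift I; pose proof (value _ _ _ (J a j) Hp) as E; inst_in E.
    now rewrite E, eq_cK, eq_cL. }
  clear Hb Hp; apply (K _ (incl_refl _) b); clear K; intros G4 I a Ha; lift I.
  - apply Bin_intro; intros G5 I j Hj; lift I; apply not_bit_elim.
    intros G6 I Hn; lift I.
    assert (Hz : prv G6 (nonzero (App h (J a (len a))))).
    { apply (search_complete _ p) with j; auto.
      apply nonzero_rewrite with (not_bit (entry a j)); auto.
      symmetry; apply Ep, incl_refl. }
    apply (not_elim _ _ _ Hz).
    change (eqv G6 (App h (J a (len a))) Zero).
    now rewrite <- (Eb _ (incl_refl _)).
  - intro HB; apply (search_sound h p a _ (len a)); auto.
    { apply nonzero_rewrite with (App b a); auto; apply Eb, incl_refl. }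
    intros G5 I j Hj Hn; lift I; apply (not_elim _ _ _ Hn).
    apply (Bin_elim _ _ j _ HB Hj); intros G6 I E; lift I;
      change (eqv G6 (App p (J a j)) Zero); rewrite (Ep _ (incl_refl _)), E;
      [apply not_bit_0|apply not_bit_1].
Qed.

Lemma SC_C_to_Contr_BW G : prv G SC_C -> prv G Contr_BW.
Proof.
  intro HS; apply allF_intro; intro gamma; inst.
  apply imp_intro; intros G1 I HC; lift I.
  apply Bin_decider; intros G2 I b Hb0 HbS; lift I.
  apply (comprehension (App b (App gamma (Var 0)))); [exact Logic.I|].
  intros G3 I alpha Ha; lift I.
  (* The default value [Zero] codes the empty sequence, which is in [Bin]. *)
  apply (comprehension (ifz (App alpha (Var 0)) (App gamma (Var 0)) Zero)); [cbn; tauto|].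
  intros G4 I gamma' Hg; lift I.
  assert (Ea : forall G5, incl G4 G5 -> forall n,
                 eqv G5 (App alpha n) (App b (App gamma n))).
  { intros G5 I n; lift I; pose proof (value _ _ _ n Ha) as E; inst_in E; exact E. }
  assert (Eg0 : forall G5, incl G4 G5 -> forall n, eqv G5 (App alpha n) Zero ->
                  eqv G5 (App gamma' n) (App gamma n)).
  { intros G5 I n E0; lift I; pose proof (value _ _ _ n Hg) as E; inst_in E.
    now rewrite E, E0, ifz_0. }
  assert (EgS : forall G5, incl G4 G5 -> forall n u, eqv G5 (App alpha n) (Suc u) ->
                  eqv G5 (App gamma' n) Zero).
  { intros G5 I n u E0; lift I; pose proof (value _ _ _ n Hg) as E; inst_in E.
    now rewrite E, E0, ifz_S. }
  clear Ha Hg.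
  assert (HB : prv G4 (AllN (Bin (App gamma' (Var 0))))).
  { apply allN_intro; intro n; inst.
    apply (zero_or_succ _ (App alpha n)); intros G5 I; [intro E|intros u E]; lift I.
    - apply Bin_rewrite with (App gamma n).
      + symmetry; apply Eg0; auto using incl_refl.
      + apply Hb0; auto using incl_refl; now rewrite <- (Ea _ (incl_refl _)).
    - apply Bin_rewrite with Zero; [symmetry; apply EgS with u|apply Bin_Zero];
        auto using incl_refl. }
  apply (prv_allFE _ _ alpha), (prv_allFE _ _ gamma') in HS; inst_in HS.
  eapply exN_elim; [apply (prv_impE _ _ _ (prv_impE _ _ _ HS HB)); clear HS HB|].
  - apply allF_intro; intro zeta; inst; apply imp_intro; intros G5 I Hz; lift I.
    apply (prv_allFE _ _ zeta) in HC; inst_in HC.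
    apply (exN_elim _ _ _ (prv_impE _ _ _ HC Hz)); intros G6 I n Hn; inst_in Hn; lift I.
    (* The second disjunct does not mention [zeta], so any [m] with [alpha(m)] nonzero is a witness;
       [K] is applied to [zeta(n)] and [zeta(n+1)]. *)
    assert (K : forall G7, incl G6 G7 -> forall m u, eqv G7 (App alpha m) (Suc u) ->
               prv G7 (ExN (Or (Apart (Var 0) (App gamma' (App zeta (Suc (Var 0))))
                                      (App gamma' (App zeta (Var 0))))
                               (Not (EqN (App alpha (Var 0)) Zero))))).
    { intros G7 _ m u E; apply prv_exNI with m; inst; apply prv_orI2.
      now apply nonzero_intro with u. }
    apply (zero_or_succ _ (App alpha (App zeta n))); intros G7 I;
      [intro E0|intros u E0]; lift I; [|eauto using incl_refl].
    apply (zero_or_succ _ (App alpha (App zeta (Suc n)))); intros G8 I;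
      [intro E1|intros u E1]; lift I; [|eauto using incl_refl].
    apply prv_exNI with n; inst; apply prv_orI1, Apart_sym.
    eapply Apart_rewrite; [symmetry; apply Eg0|symmetry; apply Eg0|];
      eauto using incl_refl.
  - intros G5 I n Hn; inst_in Hn; lift I; apply prv_exNI with n; inst.
    apply imp_intro; intros G6 I Hbin; lift I.
    apply (HbS _ (incl_refl _) (App gamma n)); auto.
    apply nonzero_rewrite with (App alpha n); auto; apply Ea, incl_refl.
Qed.

Theorem theorem9p2 : BIM_proves (Iff Contr_BW SC_C).
Proof.
  apply prv_andI; apply imp_intro; intros G _ H.
  - now apply Contr_BW_to_SC_C.
  - now apply SC_C_to_Contr_BW.
Qed.
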